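(* Let $p$ be an odd prime, $a\in\mathbb Z_p$ with $a\not\equiv-1\pmod p$, and $a'=(a-\langle a\rangle_p)/p$. Then $$\sum_{k=0}^{p-1}\binom ak\binom{-1-a}k\binom{2k}k\frac k{4^k}\equiv a(a+1)S_p(a)-(a+1)^2S_p(a+1)+\frac{a'(a'+1)}{a+1}p^3\pmod{p^4}.$$ Moreover, if $a\not\equiv0\pmod p$, then $$\sum_{k=0}^{p-1}\binom ak\binom{-1-a}k\binom{2k}k\frac k{4^k}\equiv a(a+1)\Big(2S_p(a)-\sum_{k=0}^{p-2}\binom ak\binom{-1-a}k\binom{2k}k\frac1{4^k(k+1)}\Big)\pmod{p^3}.$$
   Context: For a prime $p$, $\mathbb Z_p$ denotes the set of rational numbers whose denominator is not divisible by $p$, and congruences modulo powers of $p$ are between elements of $\mathbb Z_p$ (the difference divided by that power of $p$ lies in $\mathbb Z_p$). For $a\in\mathbb Z_p$, $\langle a\rangle_p\in\{0,1,\ldots,p-1\}$ is determined by $a\equiv\langle a\rangle_p\pmod p$. For rational $a$ and integer $k\ge0$, $\binom ak=a(a-1)\cdots(a-k+1)/k!$. Define $S_n(a)=\sum_{k=0}^{n-1}\binom ak\binom{-1-a}k\binom{2k}k\frac1{4^k}$ for $n\ge1$. *)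

(* Defs.v *)
From mathcomp Require Import all_boot all_order all_algebra.
From mathcomp Require Import ring.

Set Implicit Arguments.
Unset Strict Implicit.
Unset Printing Implicit Defensive.

Import Order.TTheory GRing.Theory Num.Theory.
Local Open Scope ring_scope.

(* Membership in Z_p, seen inside rat; denq is the reduced denominator. *)
Definition Zp_int (p : nat) (x : rat) : bool := ~~ (p %| `|denq x|)%N.

(* x = y modulo p ^ n *)
Definition Zp_eqmod (p n : nat) (x y : rat) : bool :=
  Zp_int p ((x - y) / p%:R ^+ n).

(* <a>_p, the r < p with a = r modulo p. For p prime and a in Z_p it exists and
   is unique (residueP, residue_uniq); otherwise the search may fail, and
   then returns p. *)
Definition residue (p : nat) (a : rat) : nat :=
  find (fun r : nat => Zp_eqmod p 1 a r%:R) (iota 0 p).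

Definition gbinom (a : rat) (k : nat) : rat :=
  (\prod_(i < k) (a - i%:R)) / k`!%:R.

Definition Ssum (n : nat) (a : rat) : rat :=
  \sum_(k < n) gbinom a k * gbinom (- 1 - a) k * 'C(2 * k, k)%:R
               * (1 / 4 ^+ k).

Lemma Zp_intP (p : nat) (x : rat) : prime p ->
  reflect (exists n d : int, ~~ (p %| `|d|)%N /\ x = n%:~R / d%:~R)
          (Zp_int p x).
Proof.
move=> pp; apply: (iffP idP) => [px | [n [d [pd xE]]]].
  by exists (numq x), (denq x); rewrite divq_num_den.
have d0 : d != 0 by apply: contraNneq pd => ->; rewrite absz0 dvdn0.
apply: contra pd => /dvdn_trans; apply.
have : numq x * d = n * denq x.
  apply: (@intr_inj rat); rewrite !rmorphM /= numqE {1}xE.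
  by rewrite mulrAC divfK ?intr_eq0.
move/(congr1 absz); rewrite !abszM => e.
have := dvdn_mull `|n|%N (dvdnn `|denq x|%N); rewrite -e.
by rewrite Gauss_dvdr // coprime_sym coprime_num_den.
Qed.

Lemma Zp_eqmod_natP (p : nat) (a : rat) (r : nat) : prime p -> Zp_int p a ->
  Zp_eqmod p 1 a r%:R = (p %| numq a - r%:Z * denq a)%Z.
Proof.
move=> pp pa.
have pq0 : p%:R != 0 :> rat by rewrite pnatr_eq0 -lt0n prime_gt0.
have dq0 : (denq a)%:~R != 0 :> rat by rewrite intr_eq0 denq_neq0.
have aE : (numq a - r%:Z * denq a)%:~R = (a - r%:R) * (denq a)%:~R :> rat.
  by rewrite intrB intrM mulrBl numqE.
apply/idP/idP => [/Zp_intP - /(_ pp) [n [d [pd e]]] | /dvdzP [q e]].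
  have d0 : d != 0 by apply: contraNneq pd => ->; rewrite absz0 dvdn0.
  have : (numq a - r%:Z * denq a) * d = n * denq a * p.
    apply: (@intr_inj rat); rewrite !rmorphM /= aE.
    have -> : a - r%:R = n%:~R / d%:~R * p%:R.
      by rewrite -e expr1 divfK.
    rewrite [LHS]mulrAC [_ / _ * _ * _]mulrAC divfK ?intr_eq0 //.
    by rewrite mulrAC.
  move/(congr1 absz); rewrite !abszM /= => f.
  have := dvdn_mull (`|n| * `|denq a|)%N (dvdnn p); rewrite -f.
  by rewrite Gauss_dvdl ?prime_coprime.
apply/Zp_intP => //; exists q, (denq a); split=> //.
apply: (mulIf pq0); rewrite expr1 divfK //; apply: (mulIf dq0).
rewrite -aE e intrM [RHS]mulrAC divfK //.
Qed.

Lemma residueP (p : nat) (a : rat) : prime p -> Zp_int p a ->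
  (residue p a < p)%N /\ Zp_eqmod p 1 a (residue p a)%:R.
Proof.
move=> pp pa.
have p0 : p%:Z != 0 by rewrite eqz_nat -lt0n prime_gt0.
have /coprimezP [[u v] /= uv] : coprimez (denq a) p.
  by rewrite coprimezE coprime_sym prime_coprime.
have h : has (fun r : nat => Zp_eqmod p 1 a r%:R) (iota 0 p).
  have r0 : 0 <= (numq a * u %% p)%Z by rewrite modz_ge0.
  apply/hasP; exists `|(numq a * u %% p)%Z|%N.
    by rewrite mem_iota /= -ltz_nat gez0_abs // ltz_pmod // ltz_nat prime_gt0.
  rewrite Zp_eqmod_natP // gez0_abs //; apply/dvdzP.
  exists (numq a * v + (numq a * u %/ p)%Z * denq a).
  rewrite /modz -[X in X - _](mulr1 (numq a)) -uv; ring.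
have lt : (residue p a < p)%N by move: h; rewrite has_find size_iota.
by split=> //; have := nth_find 0%N h; rewrite nth_iota.
Qed.

Lemma residue_uniq (p : nat) (a : rat) (r : nat) : prime p -> Zp_int p a ->
  (r < p)%N -> Zp_eqmod p 1 a r%:R -> r = residue p a.
Proof.
move=> pp pa rp; have [] := residueP pp pa; move: (residue p a) => s sp.
rewrite !Zp_eqmod_natP // => sa ra.
have : (p %| (r%:Z - s%:Z) * denq a)%Z.
  have -> : (r%:Z - s%:Z) * denq a =
            (numq a - s%:Z * denq a) - (numq a - r%:Z * denq a).
    by ring.
  exact: rpredB.
rewrite Gauss_dvdzl; last by rewrite coprimezE prime_coprime.
by rewrite -eqz_mod_dvd !modz_small // => /eqP [] ->.
Qed.

(* Main.v *)
(* Write t_k(a) for the k-th term of S_n(a). Both differences telescope: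
   sum_{k<n} k t_k(a) - a(a+1) S_n(a) + (a+1)^2 S_n(a+1)
     = - n^3 (t_n(a) + t_n(a+1)) / (a+1), and
   sum_{k<n} (k - a(a+1)(2k+1)/(k+1)) t_k(a) = 2 n^2 t_n(a).
   At n = p it remains to know t_p modulo p. If a = r + p a' with 0 <= r < p,
   then binom(a, p) = a' modulo p, and likewise binom(-1-a, p) = -1-a', so that
   t_p(a) = - a'(a'+1)/2 modulo p; since r < p-1, t_p(a+1) has the same value.
   In the second identity the extra term k = p-1 is t_{p-1}(a)/p, which the
   ratio of consecutive terms turns into 2 p^2 t_p(a)/(a(a+1)) modulo p^3. *)
Require Import Defs.
From mathcomp Require Import all_boot all_order all_algebra.
From mathcomp Require Import ring zify.
Import GRing.Theory.
Local Open Scope ring_scope.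

(** * Arithmetic of p-integral rationals and of their congruences *)

Lemma Zp_int_intr (p : nat) (n : int) : prime p -> Zp_int p n%:~R.
Proof.
move=> pp; apply/Zp_intP => //; exists n, 1.
by rewrite divr1 dvdn1; split=> //; case: (p) pp => [|[]].
Qed.

Lemma Zp_int_nat (p n : nat) : prime p -> Zp_int p n%:R.
Proof. exact: (@Zp_int_intr p n). Qed.

Lemma Zp_intD (p : nat) (x y : rat) :
  prime p -> Zp_int p x -> Zp_int p y -> Zp_int p (x + y).
Proof.
move=> pp px py; apply/Zp_intP => //.
exists (numq x * denq y + numq y * denq x), (denq x * denq y); split.
  by rewrite abszM Euclid_dvdM // negb_or; apply/andP.
rewrite -{1}(divq_num_den x) -{1}(divq_num_den y) !(intrD, intrM).
by rewrite addf_div ?intr_eq0 ?denq_neq0.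
Qed.

Lemma Zp_intM (p : nat) (x y : rat) :
  prime p -> Zp_int p x -> Zp_int p y -> Zp_int p (x * y).
Proof.
move=> pp px py; apply/Zp_intP => //.
exists (numq x * numq y), (denq x * denq y); split.
  by rewrite abszM Euclid_dvdM // negb_or; apply/andP.
by rewrite -{1}(divq_num_den x) -{1}(divq_num_den y) !intrM mulf_div.
Qed.

Lemma Zp_intN (p : nat) (x : rat) : Zp_int p (- x) = Zp_int p x.
Proof. by rewrite /Zp_int denqN. Qed.

Lemma Zp_intB (p : nat) (x y : rat) :
  prime p -> Zp_int p x -> Zp_int p y -> Zp_int p (x - y).
Proof. by move=> pp px py; rewrite Zp_intD // Zp_intN. Qed.

Lemma Zp_int_prod (p : nat) (I : finType) (P : pred I) (F : I -> rat) :
  prime p -> (forall i, Zp_int p (F i)) -> Zp_int p (\prod_(i | P i) F i).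
Proof.
move=> pp pF; apply: (big_ind (Zp_int p)) => //; first exact: (Zp_int_nat p 1).
by move=> x y; apply: Zp_intM.
Qed.

Lemma natr_prime_neq0 (p : nat) : prime p -> p%:R != 0 :> rat.
Proof. by move=> pp; rewrite Num.Theory.pnatr_eq0 -lt0n prime_gt0. Qed.

Lemma Zp_eqmod0 (p n : nat) (x : rat) :
  Zp_eqmod p n x 0 = Zp_int p (x / p%:R ^+ n).
Proof. by rewrite /Zp_eqmod subr0. Qed.

Lemma Zp_eqmodxx (p n : nat) (x : rat) : prime p -> Zp_eqmod p n x x.
Proof. by move=> pp; rewrite /Zp_eqmod subrr mul0r (Zp_int_nat p 0). Qed.

Lemma Zp_eqmodD (p n : nat) (x x' y y' : rat) : prime p ->
  Zp_eqmod p n x x' -> Zp_eqmod p n y y' -> Zp_eqmod p n (x + y) (x' + y').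
Proof.
move=> pp ex ey; rewrite /Zp_eqmod opprD addrACA mulrDl.
exact: Zp_intD.
Qed.

Lemma Zp_eqmod_trans (p n : nat) (y x z : rat) : prime p ->
  Zp_eqmod p n x y -> Zp_eqmod p n y z -> Zp_eqmod p n x z.
Proof.
move=> pp exy eyz; rewrite /Zp_eqmod -(subrKA y) mulrDl; exact: Zp_intD.
Qed.

Lemma Zp_eqmod_sym (p n : nat) (x y : rat) :
  Zp_eqmod p n x y = Zp_eqmod p n y x.
Proof. by rewrite /Zp_eqmod -opprB mulNr Zp_intN. Qed.

Lemma Zp_eqmodMr (p n : nat) (x x' y : rat) : prime p ->
  Zp_eqmod p n x x' -> Zp_int p y -> Zp_eqmod p n (x * y) (x' * y).
Proof.
by move=> pp ex py; rewrite /Zp_eqmod -mulrBl mulrAC Zp_intM.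
Qed.

Lemma Zp_int_eqmod (p n : nat) (x y : rat) :
  prime p -> Zp_eqmod p n x y -> Zp_int p y -> Zp_int p x.
Proof.
move=> pp exy py; rewrite -(subrK y x) Zp_intD //.
rewrite -(divfK (_ : p%:R ^+ n != 0) (x - y)) ?expf_neq0 ?natr_prime_neq0 //.
by rewrite Zp_intM // -natrX Zp_int_nat.
Qed.

(** Integrality is asked of the right-hand sides only: by [Zp_int_eqmod] it passes to the left
    ones. *)
Lemma Zp_eqmodM (p n : nat) (x x' y y' : rat) : prime p ->
  Zp_int p x' -> Zp_int p y' ->
  Zp_eqmod p n x x' -> Zp_eqmod p n y y' -> Zp_eqmod p n (x * y) (x' * y').
Proof.
move=> pp px' py' ex ey; apply: (Zp_eqmod_trans _ _ (x' * y)) => //.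
  by apply: Zp_eqmodMr => //; apply: Zp_int_eqmod ey _.
by rewrite ![x' * _]mulrC; apply: Zp_eqmodMr.
Qed.

(** A nonzero residue means that p does not divide the numerator, so exchanging numerator and
    denominator stays in Z_p. *)
Lemma Zp_intV (p : nat) (x : rat) : prime p -> Zp_int p x ->
  ~~ Zp_eqmod p 1 x 0 -> x != 0 /\ Zp_int p x^-1.
Proof.
move=> pp px; rewrite (Zp_eqmod_natP 0) // mul0r subr0 => pn.
split; first by apply: contraNneq pn => ->; rewrite dvdz0.
apply/Zp_intP => //; exists (denq x), (numq x); split=> //.
by rewrite -{1}(divq_num_den x) invf_div.
Qed.

Lemma Zp_int_natV (p n : nat) : prime p -> ~~ (p %| n)%N ->
  Zp_int p n%:R^-1.
Proof.
move=> pp pn; apply/Zp_intP => //; exists 1, n; split=> //.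
by rewrite div1r.
Qed.

Lemma Zp_eqmod_nat (p m n : nat) : prime p ->
  (m = n %[mod p])%N -> Zp_eqmod p 1 m%:R n%:R.
Proof.
move=> pp e; have dq : (p %| m%:Z - n%:Z)%Z.
  by rewrite -eqz_mod_dvd !modz_nat e.
case/dvdzP: dq => q e'; rewrite /Zp_eqmod.
have -> : m%:R - n%:R = (m%:Z - n%:Z)%:~R :> rat by rewrite intrB.
by rewrite e' intrM mulfK ?natr_prime_neq0 // Zp_int_intr.
Qed.

(** * Generalized binomial coefficients, exactly and modulo p *)

Lemma gbinom0 (x : rat) : gbinom x 0 = 1.
Proof. by rewrite /gbinom big_ord0 divr1. Qed.

Lemma factr_neq0 (k : nat) : (k`!)%:R != 0 :> rat.
Proof. by rewrite Num.Theory.pnatr_eq0 -lt0n fact_gt0. Qed.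

Lemma natrS_neq0 (k : nat) : 1 + k%:R != 0 :> rat.
Proof. by rewrite nat1r Num.Theory.pnatr_eq0. Qed.

Lemma gbinom_pascal (x : rat) (k : nat) :
  gbinom (x + 1) k.+1 = gbinom x k.+1 + gbinom x k.
Proof.
rewrite /gbinom big_ord_recl big_ord_recr /= factS natrM -nat1r.
under eq_bigr => i _ do rewrite /bump leq0n natrD opprD addrA addrK.
by field; rewrite factr_neq0 natrS_neq0.
Qed.

Lemma gbinom_absorb (x : rat) (k : nat) :
  gbinom x k.+1 = x / k.+1%:R * gbinom (x - 1) k.
Proof.
rewrite /gbinom big_ord_recl /= factS natrM -nat1r.
under eq_bigr => i _ do rewrite /bump leq0n natrD opprD addrA.
by field; rewrite factr_neq0 natrS_neq0.
Qed.

Lemma gbinomS (x : rat) (k : nat) :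
  gbinom x k.+1 = gbinom x k * (x - k%:R) / k.+1%:R.
Proof.
rewrite /gbinom big_ord_recr /= factS natrM -nat1r.
by field; rewrite factr_neq0 natrS_neq0.
Qed.

Lemma gbinom_nat (m k : nat) : gbinom m%:R k = 'C(m, k)%:R.
Proof.
elim: m k => [|m IHm] [|k]; rewrite ?gbinom0 ?bin0 //.
  by rewrite gbinom_absorb !mul0r bin0n.
by rewrite -natr1 gbinom_pascal !IHm binS natrD.
Qed.

(** Each factor (p y - 1 - j)/(j + 1) differs from -1 by p y/(j + 1), and j + 1 < p is a unit. *)
Lemma gbinom_pMB1 (p k : nat) (y : rat) : prime p -> Zp_int p y ->
  (k < p)%N -> Zp_eqmod p 1 (gbinom (p%:R * y - 1) k) ((- 1) ^+ k).
Proof.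
move=> pp py; elim: k => [|k IHk] kp.
  by rewrite gbinom0 expr0 Zp_eqmodxx.
have pk : ~~ (p %| k.+1)%N by rewrite gtnNdvd.
have pN1 : Zp_int p (- 1) by rewrite Zp_intN (Zp_int_nat p 1).
rewrite gbinomS -mulrA exprSr; apply: Zp_eqmodM => //.
- by rewrite -signr_odd; case: odd; rewrite // (Zp_int_nat p 1).
- by apply: IHk; apply: ltnW.
rewrite /Zp_eqmod.
have -> : ((p%:R * y - 1 - k%:R) / k.+1%:R - - 1) / p%:R ^+ 1 = y * k.+1%:R^-1.
  by rewrite -nat1r; field; rewrite natrS_neq0 natr_prime_neq0.
by rewrite Zp_intM // Zp_int_natV.
Qed.

Lemma prime_ndvd_fact (p k : nat) : prime p -> (k < p)%N -> ~~ (p %| k`!)%N.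
Proof.
move=> pp; elim: k => [|k IHk] kp; first by rewrite gtnNdvd ?prime_gt1.
by rewrite factS Euclid_dvdM // negb_or gtnNdvd //= IHk // ltnW.
Qed.

(* [gbinom x p] only changes modulo [p] between [x] and [x + 1] when the
   residue of [x] wraps around, so the claim reduces to [r = 0]. *)
Lemma gbinom_prime (p r : nat) (y : rat) : prime p -> odd p -> Zp_int p y ->
  (r < p)%N -> Zp_eqmod p 1 (gbinom (r%:R + p%:R * y) p) y.
Proof.
move=> pp po py.
have p0 := natr_prime_neq0 _ pp.
have pK : p = p.-1.+1 by rewrite prednK ?prime_gt0.
have pltp : (p.-1 < p)%N by rewrite [X in (_ < X)%N]pK.
elim: r => [|r IHr] rp.
  (* For r = 0, absorption gives binom(p y, p) = y binom(p y - 1, p - 1), and the last factor is 1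
     modulo p because p - 1 is even. *)
  rewrite add0r [X in gbinom _ X]pK gbinom_absorb -pK.
  have -> : p%:R * y / p%:R = y by field.
  rewrite -[X in Zp_eqmod _ _ _ X]mulr1; apply: Zp_eqmodM => //.
  - exact: (Zp_int_nat p 1).
  - exact: Zp_eqmodxx.
  have := @gbinom_pMB1 p p.-1 y pp py pltp.
  have := po; rewrite [X in odd X]pK oddS -(signr_odd _ p.-1) => /negbTE ->.
  by rewrite expr0.
have rp1 : (r < p.-1)%N by lia.
rewrite -[r.+1%:R]natr1 addrAC [X in gbinom _ X]pK gbinom_pascal -pK.
rewrite -[X in Zp_eqmod _ _ _ X]addr0; apply: Zp_eqmodD => //.
  by apply: IHr; apply: ltnW.
(* The Pascal correction vanishes modulo p: its factor of index r is exactly p y, and (p-1)! is a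
   unit. *)
rewrite Zp_eqmod0 expr1 /gbinom (bigD1 (Ordinal rp1)) //=.
set P := \prod_(_ < _ | _) _.
have -> : (r%:R + p%:R * y - r%:R) * P / p.-1`!%:R / p%:R
          = y * P * p.-1`!%:R^-1.
  by field; rewrite factr_neq0.
rewrite Zp_intM ?Zp_int_natV ?prime_ndvd_fact // Zp_intM // /P.
apply: Zp_int_prod => // i.
by rewrite Zp_intB ?Zp_intD ?Zp_intM ?Zp_int_nat.
Qed.

(** * The summand t_k(a): recurrences in k and in a, and telescoping *)

Definition Sterm (a : rat) (k : nat) : rat :=
  gbinom a k * gbinom (- 1 - a) k * 'C(2 * k, k)%:R * (1 / 4 ^+ k).

Lemma central_binS (k : nat) :
  'C(2 * k.+1, k.+1)%:R = 'C(2 * k, k)%:R * (2 * (2 * k%:R + 1)) / k.+1%:R :> rat.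
Proof.
have e : (k.+1 * 'C(2 * k.+1, k.+1) = 'C(2 * k, k) * (2 * (2 * k + 1)))%N.
  have d := mul_bin_down (2 * k).+1 k.
  have -> : (2 * k.+1)%N = (2 * k).+2 by rewrite mulnS.
  rewrite -mul_bin_diag /=; move: d => /=.
  have -> : ((2 * k).+1 - k)%N = k.+1 by lia.
  lia.
apply: (@mulIf _ k.+1%:R); first by rewrite Num.Theory.pnatr_eq0.
rewrite divfK ?Num.Theory.pnatr_eq0 // [LHS]mulrC -[LHS]natrM e !(natrM, natrD).
by ring.
Qed.

Lemma StermS (a : rat) (k : nat) :
  2 * k.+1%:R ^+ 3 * Sterm a k.+1
  = Sterm a k * (k%:R - a) * (k%:R + a + 1) * (2 * k%:R + 1).
Proof.
rewrite /Sterm !gbinomS central_binS [4 ^+ k.+1]exprS -![k.+1%:R]nat1r.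
by field; rewrite natrS_neq0 expf_neq0.
Qed.

(** Both sides are (k+1) binom(x+1, k+1), expanded by [gbinomS] and by absorption. Without division,
    the case x + 1 = k is covered too. *)
Lemma gbinom_succ_arg (x : rat) (k : nat) :
  gbinom (x + 1) k * (x + 1 - k%:R) = (x + 1) * gbinom x k.
Proof.
apply: (@mulIf _ k.+1%:R^-1); first by rewrite invr_eq0 Num.Theory.pnatr_eq0.
by rewrite -gbinomS gbinom_absorb addrK mulrAC.
Qed.

Lemma Sterm_succ_arg (a : rat) (k : nat) :
  Sterm a k * (a + 1 + k%:R) = Sterm (a + 1) k * (a + 1 - k%:R).
Proof.
have e1 := gbinom_succ_arg a k.
have := gbinom_succ_arg (- 1 - (a + 1)) k.
have -> : - 1 - (a + 1) + 1 = - 1 - a by ring.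
move=> e2; rewrite /Sterm; set c := 1 / _; set C := 'C(_, _)%:R.
apply: subr0_eq; set g := gbinom a k; set h := gbinom (- 1 - a) k.
set G := gbinom (a + 1) k; set H := gbinom (- 1 - (a + 1)) k.
(* A combination of the two shift relations in which the g H terms cancel; nothing is divided by a +
   1. *)
transitivity (C * c * (g * ((- 1 - a) * H - h * (- 1 - a - k%:R))
                       + H * ((a + 1) * g - G * (a + 1 - k%:R)))).
  by ring.
by rewrite e1 e2 !(subrr, mulr0, addr0).
Qed.

Lemma sum_Sterm_telescope (a : rat) (n : nat) :
  (a + 1) * (\sum_(k < n) Sterm a k * k%:R - a * (a + 1) * Ssum n a
             + (a + 1) ^+ 2 * Ssum n (a + 1))
  = - n%:R ^+ 3 * (Sterm a n + Sterm (a + 1) n).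
Proof.
rewrite /Ssum; elim: n => [|n IHn]; first by rewrite !big_ord0; ring.
rewrite !big_ord_recr /= -!/(Sterm _ _).
have := Sterm_succ_arg a n; have := StermS (a + 1) n; have := StermS a n.
rewrite -[n.+1%:R]natr1.
move: (\sum_(_ < n) _) IHn => A.
move: (\sum_(_ < n) _) => B; move: (\sum_(_ < n) _) => C.
move: (Sterm a n) (Sterm (a + 1) n) (Sterm a n.+1) (Sterm (a + 1) n.+1) (n%:R).
move=> x y X Y m IHn e1 e2 e3; apply: (@mulfI _ 2) => //; apply: subr0_eq.
(* Induction hypothesis, both recurrences in k and a multiple of the shift relation in a. In the
   multiplier, (2m+1)(a-m) cancels what the recurrences leave, and the rest comes from factoring m^3
   + (a+1)^3. *)
transitivity
  (2 * ((a + 1) * (A - a * (a + 1) * B + (a + 1) ^+ 2 * C)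
        - - m ^+ 3 * (x + y))
   + (2 * (m + 1) ^+ 3 * X - x * (m - a) * (m + a + 1) * (2 * m + 1))
   + (2 * (m + 1) ^+ 3 * Y
      - y * (m - (a + 1)) * (m + (a + 1) + 1) * (2 * m + 1))
   - ((2 * m + 1) * (a - m)
      + 2 * (m ^+ 2 - (a + 1) * m + (a + 1) ^+ 2 - (a + 1)))
     * (x * (a + 1 + m) - y * (a + 1 - m))); first by ring.
by rewrite IHn e1 e2 e3 !(subrr, mulr0, addr0).
Qed.

Lemma sum_Sterm_telescope_div (a : rat) (n : nat) :
  \sum_(k < n) Sterm a k * k%:R - a * (a + 1) *
    (2 * Ssum n a - \sum_(k < n) Sterm a k / k.+1%:R)
  = 2 * n%:R ^+ 2 * Sterm a n.
Proof.
rewrite /Ssum; elim: n => [|n IHn]; first by rewrite !big_ord0; ring.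
rewrite !big_ord_recr /= -!/(Sterm _ _).
have e1 : Sterm a n.+1 = Sterm a n * (n%:R - a) * (n%:R + a + 1)
           * (2 * n%:R + 1) / (2 * n.+1%:R ^+ 3).
  by rewrite -StermS mulrC mulKf // mulf_neq0 // expf_neq0 // Num.Theory.pnatr_eq0.
rewrite e1.
move: (\sum_(_ < n) _) IHn => A.
move: (\sum_(_ < n) _) => B; move: (\sum_(_ < n) _) => C IHn.
have -> : A = a * (a + 1) * (2 * B - C) + 2 * n%:R ^+ 2 * Sterm a n.
  by rewrite -IHn addrC subrK.
by rewrite -[n.+1%:R]nat1r; field; rewrite natrS_neq0.
Qed.

(** * The summand of index p, modulo p *)

Lemma central_bin_prime (p : nat) : prime p -> odd p ->
  Zp_eqmod p 1 ('C(2 * p, p)%:R * (1 / 4 ^+ p)) (1 / 2).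
Proof.
move=> pp po.
have p2 : ~~ (p %| 2)%N by rewrite dvdn_prime2 //; case: eqP po => // ->.
have e4 : Zp_eqmod p 1 (4 ^+ p) 4.
  by rewrite -natrX Zp_eqmod_nat // fermat_little.
(* This is [gbinom_prime] with residue 0 and y = 2. *)
have eC : Zp_eqmod p 1 'C(2 * p, p)%:R 2.
  rewrite -gbinom_nat mulnC natrM -[p%:R * _]add0r.
  exact: (@gbinom_prime p 0 2 pp po (Zp_int_nat p 2 pp) (prime_gt0 pp)).
have -> : 1 / 2 = 2 * 4^-1 :> rat by field.
have p4 : ~~ (p %| 4)%N by rewrite -[4%N]/(2 ^ 2)%N Euclid_dvdX // negb_and p2.
have p4p : ~~ (p %| 4 ^ p)%N by rewrite Euclid_dvdX // negb_and p4.
rewrite mul1r; apply: Zp_eqmodM => //; first exact: (Zp_int_nat p 2).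
have -> : Zp_eqmod p 1 (4 ^+ p)^-1 4^-1
   = Zp_int p ((4 - 4 ^+ p) / p%:R ^+ 1 * (4 ^ p)%N%:R^-1 * 4%:R^-1).
  congr (Zp_int p _); rewrite natrX; field.
  by rewrite expf_neq0 // natr_prime_neq0.
rewrite Zp_eqmod_sym in e4.
by rewrite Zp_intM ?(Zp_int_natV p 4) // Zp_intM // Zp_int_natV.
Qed.

Lemma Sterm_prime (p r : nat) (y : rat) : prime p -> odd p -> Zp_int p y ->
  (r < p)%N ->
  Zp_eqmod p 1 (Sterm (r%:R + p%:R * y) p) (y * (- 1 - y) * (1 / 2)).
Proof.
move=> pp po py rp.
have p2 : ~~ (p %| 2)%N by rewrite dvdn_prime2 //; case: eqP po => // ->.
have pN1y : Zp_int p (- 1 - y).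
  by rewrite Zp_intB ?Zp_intN ?(Zp_int_nat p 1).
rewrite /Sterm -[_ * _ * (1 / _)]mulrA.
apply: Zp_eqmodM => //; first exact: Zp_intM.
- apply: Zp_eqmodM => //; first exact: gbinom_prime.
  (* The reflection a -> -1-a sends residue r to p-1-r and quotient y to -1-y. *)
  have -> : - 1 - (r%:R + p%:R * y) = (p.-1 - r)%N%:R + p%:R * (- 1 - y).
    rewrite natrB; last by lia.
    by rewrite -subn1 natrB ?prime_gt0 //; ring.
  by apply: gbinom_prime => //; lia.
- exact: central_bin_prime.
Qed.

Theorem theorem4p1 (p : nat) (a : rat)
    (p_prime : prime p) (p_odd : odd p) (a_Zp : Zp_int p a)
    (a_neqN1 : ~~ Zp_eqmod p 1 a (- 1)) :
  let a' : rat := (a - (residue p a)%:R) / p%:R in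
  Zp_eqmod p 4
    (\sum_(k < p) gbinom a k * gbinom (- 1 - a) k * 'C(2 * k, k)%:R
                  * (k%:R / 4 ^+ k))
    (a * (a + 1) * Ssum p a - (a + 1) ^+ 2 * Ssum p (a + 1)
     + a' * (a' + 1) / (a + 1) * p%:R ^+ 3)
  /\
  (~~ Zp_eqmod p 1 a 0 ->
   Zp_eqmod p 3
     (\sum_(k < p) gbinom a k * gbinom (- 1 - a) k * 'C(2 * k, k)%:R
                   * (k%:R / 4 ^+ k))
     (a * (a + 1) *
      (2 * Ssum p a
       - \sum_(k < p.-1) gbinom a k * gbinom (- 1 - a) k * 'C(2 * k, k)%:R
                         * (1 / (4 ^+ k * (k%:R + 1)))))).
Proof.
move=> a'.
have p0 := natr_prime_neq0 p p_prime.
have p2 : ~~ (p %| 2)%N by rewrite dvdn_prime2 //; case: eqP p_odd => // ->.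
have pK : p = p.-1.+1 by rewrite prednK ?prime_gt0.
have Zp1 : Zp_int p 1 := Zp_int_nat p 1 p_prime.
have a1_Zp : Zp_int p (a + 1) by rewrite Zp_intD.
have [a1_neq0 a1V] : a + 1 != 0 /\ Zp_int p (a + 1)^-1.
  by apply: Zp_intV => //; move: a_neqN1; rewrite /Zp_eqmod opprK subr0.
have [rp ar] := residueP p_prime a_Zp.
(* This is [ar] up to conversion. *)
have a'_Zp : Zp_int p a' by [].
have aE : a = (residue p a)%:R + p%:R * a' by rewrite /a'; field.
(* Hence a + 1 has residue r + 1 with the same quotient a', which makes [tp1] agree with [tp]. *)
have rp1 : ((residue p a).+1 < p)%N.
  rewrite ltn_neqAle rp andbT; apply: contra a_neqN1 => /eqP rE.
  rewrite /Zp_eqmod opprK expr1.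
  have -> : (a + 1) / p%:R = a' + 1.
    by rewrite {1}aE addrAC natr1 rE; field.
  by rewrite Zp_intD.
have tp : Zp_eqmod p 1 (Sterm a p) (a' * (- 1 - a') * (1 / 2)).
  by rewrite {1}aE; apply: Sterm_prime.
have tp1 : Zp_eqmod p 1 (Sterm (a + 1) p) (a' * (- 1 - a') * (1 / 2)).
  by rewrite {1}aE addrAC natr1; apply: Sterm_prime.
have -> : \sum_(k < p) gbinom a k * gbinom (- 1 - a) k * 'C(2 * k, k)%:R
                  * (k%:R / 4 ^+ k) = \sum_(k < p) Sterm a k * k%:R.
  by apply: eq_bigr => k _; rewrite /Sterm; ring.
split.
  rewrite /Zp_eqmod.
  have e : \sum_(k < p) Sterm a k * k%:R =
    a * (a + 1) * Ssum p a - (a + 1) ^+ 2 * Ssum p (a + 1)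
    - p%:R ^+ 3 * (Sterm a p + Sterm (a + 1) p) / (a + 1).
    apply: (mulfI a1_neq0).
    have := sum_Sterm_telescope a p.
    move: (\sum_(_ < p) _) => A e; apply: subr0_eq.
    rewrite -[RHS](subrr ((a + 1) * (A - a * (a + 1) * Ssum p a
             + (a + 1) ^+ 2 * Ssum p (a + 1)))) [in X in _ = _ - X]e.
    by field.
  (* The two boundary terms add up to -a'(a'+1) modulo p; the factor p^3 in [e] lifts this to modulo
     p^4. *)
  have := Zp_eqmodD p 1 _ _ _ _ p_prime tp tp1; rewrite /Zp_eqmod => t.
  rewrite e -Zp_intN; set u := (X in Zp_int p X); set v := (X in Zp_int p X) in t.
  have -> : u = v * (a + 1)^-1.
    by rewrite /u /v; field; rewrite p0 a1_neq0.
  exact: Zp_intM.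
move=> a_neq0.
have -> : \sum_(k < p.-1) gbinom a k * gbinom (- 1 - a) k * 'C(2 * k, k)%:R
                         * (1 / (4 ^+ k * (k%:R + 1)))
  = \sum_(k < p) Sterm a k / k.+1%:R - Sterm a p.-1 / p%:R.
  rewrite [in RHS]pK big_ord_recr /= addrK.
  by apply: eq_bigr => k _; rewrite /Sterm natr1 invfM; ring.
have := sum_Sterm_telescope_div a p.
move: (\sum_(_ < p) Sterm a _ * _%:R) => A.
move: (\sum_(_ < p) Sterm a _ / _) => B e.
have := StermS a p.-1; rewrite -pK.
have -> : p.-1%:R = p%:R - 1 :> rat by rewrite [in RHS]pK -natr1 addrK.
move=> e'.
(* D is the coefficient of t_{p-1} in [StermS] at k = p - 1, since (p-1-a)(p+a) = (p-1)p - a(a+1).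
   It is a(a+1) modulo p, with quotient w, hence a unit. *)
set D := ((p%:R - 1) * p%:R - a * (a + 1)) * (2 * p%:R - 1).
set w := (p%:R - 1) * (2 * p%:R - 1) - 2 * (a * (a + 1)).
have DE : D = a * (a + 1) + p%:R * w by rewrite /D /w; ring.
have Zpp : Zp_int p p%:R by apply: Zp_int_nat.
have Zp2 : Zp_int p 2 := Zp_int_nat p 2 p_prime.
have wZp : Zp_int p w by rewrite /w Zp_intB ?Zp_intM ?Zp_intB // Zp_intM.
have DZp : Zp_int p D by rewrite DE Zp_intD // Zp_intM.
have [D0 DV] : D != 0 /\ Zp_int p D^-1.
  apply: Zp_intV => //; apply: contra a_neq0; rewrite !Zp_eqmod0 expr1 => Dp.
  have -> : a / p%:R = (D / p%:R - w) * (a + 1)^-1.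
    by rewrite DE; field; rewrite p0 a1_neq0.
  by rewrite Zp_intM // Zp_intB.
have t_Zp : Zp_int p (Sterm a p).
  apply: Zp_int_eqmod tp _ => //.
  have Zp12 : Zp_int p (1 / 2) by rewrite mul1r; apply: (Zp_int_natV p 2).
  by rewrite Zp_intM // Zp_intM // Zp_intB // Zp_intN.
have sE : Sterm a p.-1 = 2 * p%:R ^+ 3 * Sterm a p / D.
  by rewrite e'; apply: (mulIf D0); rewrite divfK //; rewrite /D; ring.
have AE : A = a * (a + 1) * (2 * Ssum p a - B) + 2 * p%:R ^+ 2 * Sterm a p.
  by rewrite -e; ring.
rewrite /Zp_eqmod sE AE.
set u := (X in Zp_int p X).
(* The error is 2 p^2 t_p (1 - a(a+1)/D), and 1 - a(a+1)/D = p w/D supplies the third power of p. *)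
have -> : u = 2 * Sterm a p * w * D^-1.
  have wE : w = (D - a * (a + 1)) / p%:R by rewrite DE; field.
  by rewrite /u wE; field; rewrite p0 D0.
by apply: Zp_intM => //; apply: Zp_intM => //; apply: Zp_intM.
Qed.
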